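(* Let $\varphi$ be a monotonic symbol for $\mathcal{S}(\mathbb{R})$, and let $C_\varphi:\mathcal{S}(\mathbb{R})\to\mathcal{S}(\mathbb{R})$, $f\mapsto f\circ\varphi$. (a) If $\varphi$ is increasing, then $C_\varphi$ is power bounded if and only if $\varphi(x)=x$ for each $x\in\mathbb{R}$. (b) If $\varphi$ is decreasing, then the following are equivalent: $C_\varphi$ is power bounded; $C_\varphi$ is mean ergodic; $\varphi(\varphi(x))=x$ for each $x\in\mathbb{R}$.
   Context: $\mathcal{S}(\mathbb{R})$ is the Schwartz space of smooth rapidly decreasing functions $f:\mathbb{R}\to\mathbb{C}$ with its usual Fréchet topology, given by the seminorms $\pi_n(f)=\sup_{x\in\mathbb{R}}\sup_{0\le j\le n}(1+|x|^2)^n|f^{(j)}(x)|$, $n\in\mathbb{N}$. A smooth function $\varphi:\mathbb{R}\to\mathbb{R}$ is a symbol for $\mathcal{S}(\mathbb{R})$ if $f\mapsto f\circ\varphi$ maps $\mathcal{S}(\mathbb{R})$ continuously into itself. A continuous linear operator $T:X\to X$ on a locally convex space is power bounded if $\{T^n:n\in\mathbb{N}\}$ is equicontinuous. It is mean ergodic if the Cesàro means $T_{[n]}=\frac1n\sum_{k=1}^nT^k$ converge to a continuous linear operator $P$ in the strong operator topology, i.e. $T_{[n]}(x)\to P(x)$ for each $x\in X$. *)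

(* Defs.v *)
From HB Require Import structures.
From mathcomp Require Import all_boot all_order all_algebra.
From mathcomp Require Import all_classical all_reals all_analysis.
From mathcomp Require Import complex ring lra.

Set Implicit Arguments.
Unset Strict Implicit.
Unset Printing Implicit Defensive.

Import Order.TTheory GRing.Theory Num.Theory.
Import numFieldNormedType.Exports.

Local Open Scope ring_scope.
Local Open Scope classical_set_scope.

(* [Rcomplex R] is the field [R[i]] seen as a vector space over [R], normed by
   the real-valued modulus; this is the structure in which functions of a real
   variable with complex values are differentiated. *)
Section Rcomplex_normedModType.
Context {R : realType}.

Lemma Rcomplex_normrM (x y : Rcomplex R) :
  @Num.norm R (Rcomplex R) (x * y) = `|x| * `|y|.
Proof. exact: (@Normc.normcM R x y). Qed.

Lemma Rcomplex_normrZ (l : R) (x : Rcomplex R) : `|l *: x| = `|l| * `|x| :> R.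
Proof.
case: x => a b.
change (Num.sqrt ((l * a) ^+ 2 + (l * b) ^+ 2) =
  `|l| * Num.sqrt (a ^+ 2 + b ^+ 2)).
by rewrite -sqrtr_sqr -sqrtrM ?sqr_ge0// !exprMn mulrDr.
Qed.

Lemma Rcomplex_scalerAr (l : R) (x y : Rcomplex R) :
  l *: (x * y) = x * (l *: y).
Proof.
case: x y => [a b] [c d]; apply/eqP; rewrite eq_complex /=.
by apply/andP; split; apply/eqP; ring.
Qed.

HB.instance Definition _ :=
  PseudoMetric.copy (Rcomplex R) (pseudoMetric_normed (Rcomplex R)).
HB.instance Definition _ := isPointed.Build (Rcomplex R) 0.
HB.instance Definition _ := 
  NormedZmod_PseudoMetric_eq.Build R (Rcomplex R) erefl.
HB.instance Definition _ :=
  PseudoMetricNormedZmod_Lmodule_isNormedModule.Build R (Rcomplex R)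
    Rcomplex_normrZ.

End Rcomplex_normedModType.

Definition smooth {R : realType} {V : normedModType R} (f : R -> V) : Prop :=
  forall n x, derivable (derive1n n f) x 1.

Section schwartz_functions.
Context {R : realType}.
Implicit Types (f g : R -> R[i]) (n : nat) (a : R[i]).

Definition schwartz_values n f : set R :=
  [set r | exists x j, (j <= n)%N /\
    r = (1 + `|x| ^+ 2) ^+ n * `|derive1n j (f : R -> Rcomplex R) x| ].

Definition is_schwartz f : Prop :=
  smooth (f : R -> Rcomplex R) /\ forall n, has_ubound (schwartz_values n f).

Definition schwartz_seminorm n f : R := sup (schwartz_values n f).

Lemma cvg_Rcomplex_mul (T : Type) (F : set_system T) (FF : Filter F)
    (h : T -> Rcomplex R) (c z : Rcomplex R) :
  h @ F --> z -> (fun t => c * h t) @ F --> c * z.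
Proof.
move=> /cvgrPdist_lt hz; apply/cvgrPdist_lt => e e0.
have c0 : 0 < `|c| + 1 :> R by rewrite ltr_wpDl.
near=> t.
rewrite -mulrBr Rcomplex_normrM.
apply: (@le_lt_trans _ _ ((`|c| + 1) * `|z - h t|)).
  by rewrite ler_wpM2r// lerDl.
rewrite -ltr_pdivlMl// mulrC; near: t; apply: hz; exact: divr_gt0.
Unshelve. all: by end_near. Qed.

Lemma is_deriveMD a (f g : R -> Rcomplex R) x :
  derivable f x 1 -> derivable g x 1 ->
  is_derive x (1 : R) (fun y => (a : Rcomplex R) * f y + g y)
    ((a : Rcomplex R) * derive1 f x + derive1 g x).
Proof.
move=> df dg.
have daf : is_derive x (1 : R) (fun y => (a : Rcomplex R) * f y)
    ((a : Rcomplex R) * 'D_1 f x).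
  have := @cvg_Rcomplex_mul _ _ _ _ a _ df.
  set u := (u in u @ _ --> _).
  have -> : u = fun h : R => h^-1 *: ((a : Rcomplex R) * f (h *: (1 : R) + x)
                                     - (a : Rcomplex R) * f x).
    by apply/funext => h; rewrite /u -mulrBr Rcomplex_scalerAr.
  move=> ul; apply: DeriveDef; first by apply/cvg_ex; eexists; exact: ul.
  by rewrite /derive; apply: cvg_lim => //; exact: ul.
rewrite !derive1E; apply: is_deriveD; exact: derivableP.
Qed.

Lemma smoothMD a (f g : R -> Rcomplex R) : smooth f -> smooth g -> forall n,
  derive1n n (fun x => (a : Rcomplex R) * f x + g x) =
  (fun x => (a : Rcomplex R) * derive1n n f x + derive1n n g x).
Proof.
move=> sf sg; elim=> [//|n IH].
rewrite derive1nS IH; apply/funext => x.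
rewrite derive1E !derive1nS; apply/derive_val/is_deriveMD.
  exact: sf.
exact: sg.
Qed.

Lemma schwartz_valuesMD n a f g M N : is_schwartz f -> is_schwartz g ->
  ubound (schwartz_values n f) M -> ubound (schwartz_values n g) N ->
  ubound (schwartz_values n (a *: f + g)) (Normc.normc a * M + N).
Proof.
move=> [sf _] [sg _] fM gN _ [x [j [jn ->]]].
have -> : derive1n j (a *: f + g : R -> Rcomplex R) x =
    (a : Rcomplex R) * derive1n j (f : R -> Rcomplex R) x
    + derive1n j (g : R -> Rcomplex R) x.
  exact: (congr1 (fun h => h x) (smoothMD a sf sg j)).
have w0 : 0 <= (1 + `|x| ^+ 2) ^+ n by rewrite exprn_ge0// addr_ge0// sqr_ge0.
apply: (le_trans (ler_wpM2l w0 (ler_normD _ _))).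
rewrite mulrDr lerD//; last by apply: gN; exists x, j.
rewrite Rcomplex_normrM mulrCA ler_wpM2l ?(normr_ge0 (a : Rcomplex R))//.
by apply: fM; exists x, j.
Qed.

Lemma derive1n_0 n : derive1n n (0 : R -> Rcomplex R) = 0.
Proof.
elim: n => // n IH; rewrite derive1nS IH; apply/funext => x.
by rewrite derive1E derive_cst.
Qed.

Lemma schwartz_values_0 n : ubound (schwartz_values n 0) 0.
Proof. by move=> _ [x [j [_ ->]]]; rewrite derive1n_0 normr0 mulr0. Qed.

Definition schwartz_pred : {pred R -> R[i]} := mem [set f | is_schwartz f].

Lemma schwartz_submod_closed : submod_closed schwartz_pred.
Proof.
split=> [|a f g]; rewrite !inE/=.
  split=> [n x|n]; first by rewrite derive1n_0; exact: derivable_cst.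
  by exists 0; exact: schwartz_values_0.
move=> [sf bf] [sg bg]; split=> [n x|n].
  have -> : derive1n n (a *: f + g : R -> Rcomplex R) =
      (fun x => (a : Rcomplex R) * derive1n n (f : R -> Rcomplex R) x
        + derive1n n (g : R -> Rcomplex R) x) by exact: (smoothMD a sf sg n).
  by have [] := is_deriveMD a (sf n x) (sg n x).
have [M fM] := bf n; have [N gN] := bg n.
by exists (Normc.normc a * M + N); exact: schwartz_valuesMD.
Qed.

End schwartz_functions.

HB.instance Definition _ (R : realType) :=
  GRing.isSubmodClosed.Build R[i] (R -> R[i]) (@schwartz_pred R)
    schwartz_submod_closed.

Record schwartz (R : realType) : Type := Schwartz {
  schwartz_fun :> R -> R[i];
  _ : schwartz_fun \in @schwartz_pred R }.

HB.instance Definition _ (R : realType) := [isSub for @schwartz_fun R].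
HB.instance Definition _ (R : realType) := [Choice of schwartz R by <:].
HB.instance Definition _ (R : realType) :=
  [SubChoice_isSubLmodule of schwartz R by <:].

Section schwartz_topology.
Context {R : realType}.
Implicit Types (f g : schwartz R) (n N : nat).

Lemma schwartzP f : is_schwartz f.
Proof. by case: f => f /=; rewrite inE. Qed.

Local Notation p_ n f := (schwartz_seminorm n f).

Let values0 n f : schwartz_values n f !=set0.
Proof.
exists ((1 + `|0 : R| ^+ 2) ^+ n * `|derive1n 0 (f : R -> Rcomplex R) 0|).
by exists 0, 0%N.
Qed.

Let seminorm_ub n f : ubound (schwartz_values n f) (p_ n f).
Proof. by apply: sup_upper_bound; split => //; exact: (schwartzP f).2. Qed.

Let seminorm_le n f M : ubound (schwartz_values n f) M -> p_ n f <= M.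
Proof. by move=> fM; apply: ge_sup. Qed.

Lemma schwartz_seminormMD n (a : R[i]) f g :
  p_ n (a *: f + g) <= Normc.normc a * p_ n f + p_ n g.
Proof.
apply/seminorm_le/schwartz_valuesMD; [exact: schwartzP..| |].
  exact: seminorm_ub.
exact: seminorm_ub.
Qed.

Lemma schwartz_seminorm_ge0 n f : 0 <= p_ n f.
Proof.
have [r fr] := values0 n f; apply: le_trans (seminorm_ub fr).
by case: fr => x [j [_ ->]]; rewrite mulr_ge0// exprn_ge0// addr_ge0// sqr_ge0.
Qed.

Lemma schwartz_seminormD n f g : p_ n (f + g) <= p_ n f + p_ n g.
Proof.
have := schwartz_seminormMD n 1 f g; rewrite scale1r.
rewrite (_ : Normc.normc 1 = 1 :> R) ?mul1r//.
by rewrite /Normc.normc/= expr1n expr0n addr0 sqrtr1.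
Qed.

Lemma schwartz_seminorm0 n : p_ n (0 : schwartz R) = 0.
Proof.
apply/eqP; rewrite eq_le schwartz_seminorm_ge0 andbT.
by apply: seminorm_le; exact: schwartz_values_0.
Qed.

Lemma schwartz_seminormN n f : p_ n (- f) = p_ n f.
Proof.
have N1 : Normc.normc (-1) = 1 :> R.
  by rewrite /Normc.normc/= sqrrN expr1n oppr0 expr0n addr0 sqrtr1.
have le g : p_ n (- g) <= p_ n g.
  have := schwartz_seminormMD n (-1) g 0.
  by rewrite schwartz_seminorm0 !addr0 scaleN1r N1 mul1r.
by apply/eqP; rewrite eq_le le/= -{1}(opprK f) le.
Qed.

Lemma schwartz_seminormZ n (a : R[i]) f :
  p_ n (a *: f) <= Normc.normc a * p_ n f.
Proof.
by have := schwartz_seminormMD n a f 0; rewrite schwartz_seminorm0 !addr0.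
Qed.

(* The locally convex topology generated by the seminorms: finite intersections
   of seminorm balls centred at [f] form a neighbourhood basis of [f]. *)
Definition schwartz_ball f N (e : R) : set (schwartz R) :=
  [set g | forall n, (n <= N)%N -> schwartz_seminorm n (g - f) < e].

Definition schwartz_nbhs f : set_system (schwartz R) :=
  [set U | exists N e, 0 < e /\ schwartz_ball f N e `<=` U].

HB.instance Definition _ := hasNbhs.Build (schwartz R) schwartz_nbhs.

Lemma schwartz_ballxx f N (e : R) : 0 < e -> schwartz_ball f N e f.
Proof. by move=> e0 n _; rewrite subrr [ltLHS]schwartz_seminorm0. Qed.

Lemma schwartz_ball_near f N (e : R) : 0 < e -> nbhs f (schwartz_ball f N e).
Proof. by move=> e0; apply: (ex_intro _ N); exists e; split. Qed.

Lemma schwartz_ball_triangle f g h N e1 e2 :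
  schwartz_ball f N e1 g -> schwartz_ball g N e2 h ->
  schwartz_ball f N (e1 + e2) h.
Proof.
move=> fg gh n nN; rewrite -(subrKA g).
apply: (le_lt_trans (schwartz_seminormD _ _ _)).
by rewrite addrC ltrD//; [exact: fg|exact: gh].
Qed.

Let nbhs_proper f : ProperFilter (nbhs f).
Proof.
apply: Build_ProperFilter.
  by move=> [N [e [e0]]]; apply; exact: schwartz_ballxx e0.
split.
- by apply: (ex_intro _ 0%N); exists 1; split.
- move=> P Q [N [e [e0 P1]]] [M [d [d0 Q1]]].
  apply: (ex_intro _ (maxn N M)); exists (Num.min e d).
  split; first by rewrite lt_min e0.
  move=> g fg; split; [apply: P1|apply: Q1] => n nN.
    have := fg n; rewrite leq_max nN => /(_ isT).
    by rewrite lt_min => /andP[].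
  have := fg n; rewrite leq_max nN orbT => /(_ isT).
  by rewrite lt_min => /andP[].
- move=> P Q PQ [N [e [e0 P1]]]; apply: (ex_intro _ N); exists e; split=> //.
  exact: subset_trans PQ.
Qed.

Let nbhs_singleton f (A : set (schwartz R)) : nbhs f A -> A f.
Proof. by move=> [N [e [e0]]]; apply; exact: schwartz_ballxx. Qed.

Let nbhs_nbhs f (A : set (schwartz R)) : nbhs f A -> nbhs f (nbhs^~ A).
Proof.
move=> [N [e [e0 fA]]]; apply: (ex_intro _ N).
exists (e / 2); split; first exact: divr_gt0.
move=> g fg; apply: (ex_intro _ N).
exists (e / 2); split; first exact: divr_gt0.
by move=> h gh; apply: fA; rewrite (splitr e); exact: schwartz_ball_triangle gh.
Qed.

HB.instance Definition _ :=
  Nbhs_isNbhsTopological.Build (schwartz R) nbhs_proper nbhs_singleton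
    nbhs_nbhs.

Let add_cont : continuous (fun x : schwartz R * schwartz R => x.1 + x.2).
Proof.
move=> [f g] U [N [e [e0 eU]]].
exists (schwartz_ball f N (e / 2), schwartz_ball g N (e / 2)).
  by split; apply: schwartz_ball_near; exact: divr_gt0.
move=> [f' g'] /= [ff' gg']; apply: eU => n nN /=.
rewrite opprD addrACA.
apply: (le_lt_trans (schwartz_seminormD n (f' - f) (g' - g))).
by rewrite (splitr e) ltrD//; [exact: ff'|exact: gg'].
Qed.

Let scale_cont : continuous (fun z : R[i]^o * schwartz R => z.1 *: z.2).
Proof.
move=> [a f] U [N [e [e0 eU]]].
pose M := \sum_(n < N.+1) p_ n f + 1.
have M0 : 0 < M.
  by rewrite ltr_wpDl// sumr_ge0// => i _; exact: schwartz_seminorm_ge0.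
have pM n : (n <= N)%N -> p_ n f <= M.
  move=> nN; rewrite /M (bigD1 (Ordinal (nN : (n < N.+1)%N)))//= -addrA lerDl.
  rewrite addr_ge0// sumr_ge0// => i _; exact: schwartz_seminorm_ge0.
pose L := Normc.normc a + 1.
have a0 : 0 <= Normc.normc a :> R by exact: (normr_ge0 (a : Rcomplex R)).
have L0 : 0 < L by rewrite ltr_wpDl.
pose d := Num.min 1 (e / 2 / M).
have d0 : 0 < d by rewrite lt_min ltr01/= !divr_gt0.
exists ([set b : R[i]^o | Normc.normc (b - a) < d],
        schwartz_ball f N (e / 2 / L)).
  split=> /=; last by apply: schwartz_ball_near; rewrite !divr_gt0.
  apply/nbhs_ballP; exists (d%:C)%C => /=; first by rewrite ltcR.
  move=> b; rewrite -ball_normE /= distrC.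
  by rewrite -ltcR.
move=> [b g] /= [ab fg]; apply: eU => n nN.
change (p_ n ((b : R[i]) *: g - (a : R[i]) *: f) < e).
have -> : (b : R[i]) *: g - (a : R[i]) *: f =
    (b : R[i]) *: (g - f) + (b - a : R[i]) *: f.
  by rewrite scalerBr scalerBl addrA subrK.
apply: (le_lt_trans (schwartz_seminormD _ _ _)).
have bL : Normc.normc b <= L.
  rewrite -(subrK a b); apply: le_trans (le_normcD _ _) _.
  rewrite addrC lerD2l; apply: ltW; apply: lt_le_trans ab _.
  by rewrite ge_min lexx.
rewrite (splitr e) ltr_leD//.
  apply: (le_lt_trans (schwartz_seminormZ _ _ _)).
  apply: (@le_lt_trans _ _ (L * p_ n (g - f))).
    by rewrite ler_wpM2r//; exact: schwartz_seminorm_ge0.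
  by rewrite -ltr_pdivlMl// mulrC; exact: fg.
apply: (le_trans (schwartz_seminormZ _ _ _)).
apply: (@le_trans _ _ (e / 2 / M * M)); last by rewrite divfK// gt_eqF.
apply: ler_pM => //.
- exact: (normr_ge0 (b - a : Rcomplex R)).
- exact: schwartz_seminorm_ge0.
- by apply: ltW; apply: lt_le_trans ab _; rewrite ge_min lexx orbT.
- exact: pM.
Qed.

Lemma schwartz_ball_convex f g h N (e l : R) : 0 <= l -> l <= 1 ->
  schwartz_ball f N e g -> schwartz_ball f N e h ->
  schwartz_ball f N e ((l%:C)%C *: g + ((1 - l)%:C)%C *: h).
Proof.
move=> l0 l1 fg fh n nN.
have -> : (l%:C)%C *: g + ((1 - l)%:C)%C *: h - f =
    (l%:C)%C *: (g - f) + ((1 - l)%:C)%C *: (h - f) :> schwartz R.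
  rewrite !scalerBr addrACA -opprD -scalerDl -rmorphD/=.
  by rewrite (addrC l) subrK scale1r.
have nl (r : R) : 0 <= r -> Normc.normc (r%:C)%C = r.
  by move=> r0; rewrite /Normc.normc/= expr0n addr0 sqrtr_sqr ger0_norm.
apply: (le_lt_trans (schwartz_seminormD _ _ _)).
apply: le_lt_trans.
  exact: (lerD (schwartz_seminormZ _ _ _) (schwartz_seminormZ _ _ _)).
rewrite !nl ?subr_ge0//.
have := fg n nN; have := fh n nN.
move: (p_ n (g - f)) (p_ n (h - f)) => u v ve ue.
have [uv|/ltW vu] := leP u v.
  by apply: le_lt_trans ve; nra.
by apply: le_lt_trans ue; nra.
Qed.

Let locally_convex :
  exists2 B : set_system (schwartz R),
    (forall b, b \in B -> convex_set b) & basis B.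
Proof.
exists [set B | exists f N e, B = schwartz_ball f N e].
  move=> b /set_mem [f [N [e ->]]] g h k /set_mem fg /set_mem fh.
  apply/mem_set.
  have kl : k%:num = ((complex.Re (k%:num : R[i]))%:C)%C by rewrite RRe_real.
  have [l0 l1] : 0 <= complex.Re (k%:num : R[i]) /\
      complex.Re (k%:num : R[i]) <= 1.
    by rewrite -!lecR -kl; split; [exact: ge0|exact: le1].
  have := schwartz_ball_convex l0 l1 fg fh.
  by rewrite rmorphB/= -kl.
split=> [_ [f [N [e ->]]]|f U [N [e [e0 eU]]]]; last first.
  exists (schwartz_ball f N e) => //; split; last exact: schwartz_ballxx.
  by exists f, N, e.
rewrite openE => g fg.
have : \forall h \near g, forall n : 'I_N.+1, p_ n (h - f) < e.
  apply: (@filter_forall _ 'I_N.+1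
    (fun (n : 'I_N.+1) (h : schwartz R) => p_ n (h - f) < e) (nbhs g)) => n.
  have e0 : 0 < e - p_ n (g - f).
    by rewrite subr_gt0; apply: fg; rewrite -ltnS; exact: ltn_ord.
  apply: (ex_intro _ (n : nat)); exists (e - p_ n (g - f)); split=> //.
  move=> h /(_ n (leqnn _)) gh.
  have := schwartz_seminormD n (h - g) (g - f); rewrite subrKA => /le_lt_trans.
  apply.
  by rewrite -ltrBrDr.
apply: filterS => h fh n nN; exact: (fh (Ordinal (nN : (n < N.+1)%N))).
Qed.

(* In this version of the library the factory below only installs the uniform
   structure, so the remaining mixins are declared one by one after it. *)
HB.instance Definition _ :=
  PreTopologicalLmod_isTvs.Build R[i] (schwartz R) add_cont scale_cont
    locally_convex.
HB.instance Definition _ :=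
  PreTopologicalNmodule_isTopologicalNmodule.Build (schwartz R) add_cont.
HB.instance Definition _ :=
  TopologicalNmodule_isTopologicalLmodule.Build R[i] (schwartz R) scale_cont.
HB.instance Definition _ :=
  Uniform_isTvs.Build R[i] (schwartz R) locally_convex.

End schwartz_topology.

Section operators.
Context {K : numFieldType} {X : tvsType K}.
Implicit Type T : {linear X -> X}.

(* Equicontinuity of the iterates, written out because the library's
   [equicontinuous] demands a pointed target. *)
Definition power_bounded T : Prop :=
  forall x (E : set (X * X)), entourage E ->
    \forall y \near x, forall n, E (iter n T x, iter n T y).

Definition cesaro_mean T n (x : X) : X :=
  n%:R^-1 *: \sum_(1 <= k < n.+1) iter k T x.

Definition mean_ergodic T : Prop :=
  exists P : {linear X -> X}, continuous P /\
    forall x, cesaro_mean T n x @[n --> \oo] --> P x.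

End operators.

Definition preserves_schwartz {R : realType} (phi : R -> R) : Prop :=
  forall f : R -> R[i], is_schwartz f -> is_schwartz (f \o phi).

Definition schwartz_comp {R : realType} (phi : R -> R)
    (phiS : preserves_schwartz phi) (f : schwartz R) : schwartz R :=
  Schwartz (mem_set (phiS f (schwartzP f))).

Record symbol (R : realType) : Type := Symbol {
  symbol_fun :> R -> R;
  symbol_smooth : smooth symbol_fun;
  symbol_preserves : preserves_schwartz symbol_fun;
  symbol_continuous : continuous (schwartz_comp symbol_preserves) }.

Definition comp_op {R : realType} (phi : symbol R) : schwartz R -> schwartz R :=
  schwartz_comp (symbol_preserves phi).

Lemma comp_op_linear (R : realType) (phi : symbol R) : linear (comp_op phi).
Proof. by move=> a f g; apply: val_inj. Qed.

HB.instance Definition _ (R : realType) (phi : symbol R) :=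
  GRing.isLinear.Build R[i] (schwartz R) (schwartz R) *:%R (comp_op phi)
    (comp_op_linear phi).

(* Main.v *)
Require Import Defs.
From HB Require Import structures.
From mathcomp Require Import all_boot all_order all_algebra.
From mathcomp Require Import all_classical all_reals all_analysis.
From mathcomp Require Import complex ring lra.

Import Order.TTheory GRing.Theory Num.Theory.
Import numFieldNormedType.Exports.
Local Open Scope ring_scope.
Local Open Scope classical_set_scope.

Set Implicit Arguments.
Unset Strict Implicit.
Unset Printing Implicit Defensive.

(** The theorem reduces to the dynamics of a monotone continuous surjection of
    the line, tested on Gaussians.

    A symbol is proper, since a Gaussian composed with it has to decay
    ([symbol_proper]); a monotone symbol is therefore onto ([symbol_onto]), and
    every point [x] starts a backward orbit: [z 0 = x], [phi (z m.+1) = z m].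

    Increasing case.  Suppose [x < phi x]; the backward orbit of [x] decreases.
    Let [f] be the Gaussian centred at [x], so that the [m]-th iterate of the
    composition operator satisfies [(T^m f) (z m) = f x = 1].  Power boundedness
    gives one bound for the decay and for the Lipschitz constants of all the
    [T^m f].  The decay keeps [z m] bounded, so it converges to a fixed point
    [a < x]; and the Lipschitz bound forces
    [1 - f a = |(T^m f) (z m) - (T^m f) a| <= C |z m - a| --> 0], which is absurd
    because [f a < 1].  The case [phi x < x] follows by reflecting the line
    ([bounded_orbits_id]).

    Decreasing case.  Put [psi = phi o phi], which is increasing.  If the operator
    is power bounded, the increasing case applies to [psi].  If it is mean
    ergodic with limit [P], then [h = Re (P f)] is the pointwise limit of the
    Cesaro means along [psi]-orbits of [G = (f o phi + f o psi) / 2].  Suppose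
    [psi x <> x]; one may take [x] above the fixed point [p] of [phi].  The
    forward and the backward [psi]-orbit of [x] are monotone, and each tends to a
    fixed point of [psi] or to infinity; the decreasing one of the two converges,
    being bounded below by [p].  By Cesaro's lemma [h] is constant on the backward
    orbit, equal to the limit of [G] along the forward one; as [h] is continuous, vanishes
    at infinity and agrees with [G] at fixed points, [G] takes the same value at
    two fixed points [c < d] of [psi] in the half-line from [p] on, or vanishes at one
    ([orbit_mean_alternative]).  A Gaussian [f] concentrated enough at [d] excludes
    the first and any Gaussian the second ([mean_ergodic_decreasing]).

    Conversely, if [phi] is an involution then the iterates of the operator take
    two values only, and its Cesaro means differ from [(T + id) / 2] by a multiple
    of [T - id] of size [1 / n] ([cesaro_mean_involution]). *)

(** * Real parts of complex-valued functions *)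

Section real_and_complex_values.
Context {R : realType}.

Lemma norm_real_complex (a : R) : `|(a%:C)%C : Rcomplex R| = `|a| :> R.
Proof.
change (Num.sqrt (a ^+ 2 + 0 ^+ 2) = `|a|).
by rewrite expr0n addr0 sqrtr_sqr.
Qed.

Lemma norm_Re_le (z : Rcomplex R) : `|complex.Re z| <= `|z| :> R.
Proof.
case: z => a b; change (`|a| <= Num.sqrt (a ^+ 2 + b ^+ 2)).
rewrite -sqrtr_sqr ler_sqrt.
  by rewrite lerDl sqr_ge0.
by rewrite addr_ge0// sqr_ge0.
Qed.

Lemma cvg_Re (T : Type) (F : set_system T) (FF : Filter F)
    (h : T -> Rcomplex R) (z : Rcomplex R) :
  h @ F --> z -> (fun t => complex.Re (h t)) @ F --> complex.Re z.
Proof.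
move=> /cvgrPdist_lt hz; apply/cvgrPdist_lt => e /hz; apply: filterS => t.
apply: le_lt_trans; rewrite (_ : _ - _ = complex.Re (z - h t)) ?norm_Re_le//.
by case: z {hz} => a b; case: (h t).
Qed.

Lemma cvg_real_complex (T : Type) (F : set_system T) (FF : Filter F)
    (h : T -> R) (a : R) :
  h @ F --> a -> (fun t => (h t)%:C%C : Rcomplex R) @ F --> (a%:C%C : Rcomplex R).
Proof.
move=> /cvgrPdist_lt ha; apply/cvgrPdist_lt => e /ha; apply: filterS => t.
by rewrite -[X in X < _ -> _]norm_real_complex rmorphB.
Qed.

Lemma is_derive_Re (f : R -> Rcomplex R) x : derivable f x 1 ->
  is_derive x (1 : R) (fun y => complex.Re (f y)) (complex.Re (derive1 f x)).
Proof.
move=> df; have := cvg_Re _ df; rewrite derive1E.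
set u := (u in u @ _ --> _).
have -> : u = fun h : R =>
    h^-1 *: (complex.Re (f (h *: (1 : R) + x)) - complex.Re (f x)).
  apply/funext => h; rewrite /u /=.
  by case: (f (h *: 1 + x)) (f x) => a b [c d].
move=> ul; apply: DeriveDef; first by apply/cvg_ex; eexists; exact: ul.
by rewrite /derive; apply: cvg_lim => //; exact: ul.
Qed.

Lemma is_derive_real_complex (g : R -> R) x dg : is_derive x (1 : R) g dg ->
  is_derive x (1 : R) (fun y => (g y)%:C%C : Rcomplex R) (dg%:C%C : Rcomplex R).
Proof.
move=> [gx <-]; have := cvg_real_complex _ gx.
set u := (u in u @ _ --> _).
have -> : u = fun h : R =>
    h^-1 *: ((g (h *: (1 : R) + x))%:C%C - (g x)%:C%C : Rcomplex R).
  apply/funext => h; rewrite /u; apply/eqP; rewrite eq_complex /=.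
  by rewrite subr0 mulr0 !eqxx.
move=> ul; apply: DeriveDef; first by apply/cvg_ex; eexists; exact: ul.
by rewrite /derive; apply: cvg_lim => //; exact: ul.
Qed.

End real_and_complex_values.

(** * Gaussians are Schwartz functions *)

Section gaussian.
Context {R : realType}.
Implicit Types (p q : {poly R}) (L c x : R).

Definition gauss L c x : R := expR (- (L * (x - c) ^+ 2)).

Lemma gauss_gt0 L c x : 0 < gauss L c x. Proof. exact: expR_gt0. Qed.

Lemma gauss_center L c : gauss L c c = 1.
Proof. by rewrite /gauss subrr expr0n mulr0 oppr0 expR0. Qed.

Lemma gauss_opp L c x : gauss L c (- x) = gauss L (- c) x.
Proof. by rewrite /gauss -opprD sqrrN opprK. Qed.

Lemma is_derive_poly_expR p q x :
  is_derive x (1 : R) (fun y => p.[y] * expR q.[y])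
    ((p^`() + p * q^`()).[x] * expR q.[x]).
Proof.
have dp := is_derive_poly p x.
have de := @is_derive1_comp R expR (horner q) x _ _
  (is_derive_expR q.[x]) (is_derive_poly q x).
have dpe := @is_deriveM _ _ (horner p) (expR \o horner q) x 1 _ _ dp de.
apply: (trigger_derive dpe).
by rewrite /= hornerD hornerM /GRing.scale /=; ring.
Qed.

(** The functions [p * exp q] with [q] fixed are closed under derivation, which is
    how all derivatives of a Gaussian are controlled at once. *)
Lemma derive1n_poly_expR p q n : exists r,
  derive1n n (fun y => (p.[y] * expR q.[y])%:C%C : Rcomplex R) =
  (fun y => (r.[y] * expR q.[y])%:C%C).
Proof.
elim: n => [|n [r IH]]; first by exists p.
exists (r^`() + r * q^`()); rewrite derive1nS IH; apply/funext => x.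
rewrite derive1E; apply: derive_val.
exact/is_derive_real_complex/is_derive_poly_expR.
Qed.

(** With [t = L (x - c)^2], this is [t^k.+1 <= k.+1! * exp t], after bounding a
    power of [|x - c|] by [1] plus an even one. *)
Lemma pow_gauss_bounded L c k : 0 < L ->
  exists C, forall x, `|x - c| ^+ k * gauss L c x <= C.
Proof.
move=> L0; exists (1 + k.+1`!%:R / L ^+ k.+1) => x.
have e1 : gauss L c x <= 1.
  by rewrite -expR0 ler_expR oppr_le0 mulr_ge0 ?sqr_ge0// ltW.
have pow_le : `|x - c| ^+ k <= 1 + ((x - c) ^+ 2) ^+ k.+1.
  have [le1|/ltW ge1] := leP `|x - c| 1.
    apply: ler_wpDr; first by rewrite exprn_ge0 ?sqr_ge0.
    exact: exprn_ile1.
  rewrite -real_normK ?num_real// -exprM ler_wpDl// ler_weXn2l//.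
  by rewrite (leq_trans (leqnSn k))// leq_pmull.
have t0 : 0 <= L * (x - c) ^+ 2 by rewrite mulr_ge0 ?sqr_ge0// ltW.
have ek : ((x - c) ^+ 2) ^+ k.+1 * gauss L c x <= k.+1`!%:R / L ^+ k.+1.
  rewrite /gauss expRN ler_pdivrMr ?expR_gt0//.
  rewrite mulrAC ler_pdivlMr ?exprn_gt0//.
  rewrite -exprMn (mulrC _ L) -ler_pdivrMl ?ltr0n ?fact_gt0//.
  rewrite [leLHS]mulrC.
  by apply: le_trans (expR_ge1Dxn k t0); rewrite lerDr.
apply: (le_trans (ler_wpM2r (expR_ge0 _) pow_le)).
by rewrite mulrDl mul1r lerD.
Qed.

Lemma poly_gauss_bounded p L c : 0 < L ->
  exists C, forall x, `|p.[x]| * gauss L c x <= C.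
Proof.
move=> L0.
(* Multiplying a polynomial by the variable shifts [k]; hence the extra power. *)
suff H q : forall k, exists C, forall x,
    `|q.[x - c]| * (`|x - c| ^+ k * gauss L c x) <= C.
  have [C HC] := H (p \Po ('X + c%:P)) 0%N; exists C => x.
  by have := HC x; rewrite horner_comp !(hornerE, subrK, expr0, mul1r).
elim/poly_ind: q => [|q a IH] k.
  by exists 0 => x; rewrite horner0 normr0 mul0r.
have [C HC] := IH k.+1; have [D HD] := pow_gauss_bounded c k L0.
exists (C + `|a| * D) => x.
have g0 : 0 <= `|x - c| ^+ k * gauss L c x.
  by rewrite mulr_ge0 ?expR_ge0 ?exprn_ge0.
rewrite hornerMXaddC; apply: (le_trans (ler_wpM2r g0 (ler_normD _ _))).
rewrite mulrDl lerD//; last by rewrite ler_wpM2l.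
by rewrite normrM -mulrA (mulrA `|x - c|) -exprS.
Qed.

Lemma gauss_is_schwartz L c : 0 < L ->
  is_schwartz (fun x => (gauss L c x)%:C%C).
Proof.
move=> L0; pose q : {poly R} := - (L *: ('X - c%:P) ^+ 2).
have gq : (fun x => (gauss L c x)%:C%C : Rcomplex R) =
    (fun x => ((1%:P).[x] * expR q.[x])%:C%C).
  by apply/funext => x; rewrite /gauss /q !hornerE.
split=> [n x|n].
  have [r rE] := derive1n_poly_expR 1%:P q n.
  rewrite gq rE.
  by have [] := is_derive_real_complex (is_derive_poly_expR r q x).
(* A single constant has to serve the finitely many orders of derivation. *)
suff H m : exists C, forall x j, (j <= m)%N ->
    (1 + `|x| ^+ 2) ^+ n *
      `|derive1n j (fun y => (gauss L c y)%:C%C : Rcomplex R) x| <= C.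
  have [C HC] := H n; exists C => _ [x [j [jn ->]]].
  exact: HC.
have one j : exists C, forall x, (1 + `|x| ^+ 2) ^+ n *
      `|derive1n j (fun y => (gauss L c y)%:C%C : Rcomplex R) x| <= C.
  have [r rE] := derive1n_poly_expR 1%:P q j.
  have [C HC] := poly_gauss_bounded ((1 + 'X ^+ 2) ^+ n * r) c L0.
  exists C => x; apply: le_trans (HC x).
  rewrite gq rE norm_real_complex normrM (ger0_norm (expR_ge0 _)) mulrA.
  rewrite /gauss /q !hornerE normrM normrX.
  by rewrite (ger0_norm (addr_ge0 _ (sqr_ge0 _)))// real_normK ?num_real.
elim: m => [|m [C IH]].
  have [C HC] := one 0%N; exists C => x j; rewrite leqn0 => /eqP ->.
  exact: HC.
have [D HD] := one m.+1; exists (Num.max C D) => x j.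
rewrite leq_eqVlt => /predU1P[->|jm]; first by rewrite le_max HD orbT.
by rewrite le_max IH.
Qed.

End gaussian.

(** * Pointwise estimates from the Schwartz seminorms *)

Section schwartz_estimates.
Context {R : realType}.
Implicit Types (f : schwartz R) (k n N : nat).

Definition gauss_schwartz (L c : R) (L0 : 0 < L) : schwartz R :=
  Schwartz (mem_set (gauss_is_schwartz c L0)).

Lemma schwartz_values_le n f x j : (j <= n)%N ->
  (1 + `|x| ^+ 2) ^+ n * `|derive1n j (f : R -> Rcomplex R) x| <=
    schwartz_seminorm n f.
Proof.
move=> jn; apply: sup_upper_bound; last by exists x, j.
split; last exact: (schwartzP f).2.
by exists ((1 + `|x| ^+ 2) ^+ n * `|derive1n j (f : R -> Rcomplex R) x|), x, j.
Qed.

Lemma schwartz_seminorm_mono n N f : (n <= N)%N ->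
  schwartz_seminorm n f <= schwartz_seminorm N f.
Proof.
move=> nN; apply: ge_sup.
  by exists ((1 + `|0 : R| ^+ 2) ^+ n * `|derive1n 0 (f : R -> Rcomplex R) 0|), 0, 0%N.
move=> _ [x [j [jn ->]]].
apply: le_trans (schwartz_values_le f x (leq_trans jn nN)).
by rewrite ler_wpM2r// ler_weXn2l// lerDl sqr_ge0.
Qed.

Lemma schwartz_derivable f x : derivable (f : R -> Rcomplex R) x 1.
Proof. exact: ((schwartzP f).1 0%N x). Qed.

Arguments schwartz_derivable : clear implicits.

Lemma Re_schwartz_le0 f x : `|complex.Re (f x)| <= schwartz_seminorm 0 f.
Proof.
apply: le_trans (norm_Re_le _) _.
by have := schwartz_values_le f x (leqnn 0); rewrite expr0 mul1r.
Qed.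

Lemma Re_schwartz_le1 f x :
  (1 + x ^+ 2) * `|complex.Re (f x)| <= schwartz_seminorm 1 f.
Proof.
apply: le_trans (schwartz_values_le f x (leq0n 1)).
by rewrite expr1 real_normK ?num_real// ler_wpM2l ?addr_ge0 ?sqr_ge0// norm_Re_le.
Qed.

Lemma Re_schwartz_lipschitz f x y :
  `|complex.Re (f x) - complex.Re (f y)| <= schwartz_seminorm 1 f * `|x - y|.
Proof.
wlog yx : x y / y <= x.
  move=> H; have [/ltW/H|/H//] := ltP x y.
  by rewrite distrC (distrC y).
have df z := @is_derive_Re R f z (schwartz_derivable f z).
have [|z _ ->] := @MVT_segment R (fun z => complex.Re (f z)) _ y x yx
  (fun z _ => df z).
  apply: continuous_subspaceT => z.
  by apply/differentiable_continuous/derivable1_diffP; have [] := df z.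
rewrite normrM ler_wpM2r//; apply: le_trans (norm_Re_le _) _.
apply: le_trans (schwartz_values_le f z (leqnn 1)).
by rewrite expr1 derive1n1 ler_peMl// lerDl sqr_ge0.
Qed.

Lemma Re_schwartz_continuous f : continuous (fun x => complex.Re (f x)).
Proof.
move=> x; apply/differentiable_continuous/derivable1_diffP.
by have [] := @is_derive_Re R f x (schwartz_derivable f x).
Qed.

Lemma Re_schwartz_vanishes f : complex.Re (f x) @[x --> +oo] --> (0 : R).
Proof.
apply/cvgrPdist_lt => e e0; near=> x; rewrite sub0r normrN.
have x1 : 1 <= x by near: x; exact: nbhs_pinfty_ge.
have xe : schwartz_seminorm 1 f < e * x.
  by rewrite mulrC -ltr_pdivrMr//; near: x; apply: nbhs_pinfty_gt; exact: num_real.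
have := Re_schwartz_le1 f x.
have := normr_ge0 (complex.Re (f x)); move: `|_| => t t0 le1.
rewrite -(@ltr_pM2r _ x) ?(lt_le_trans _ x1)//.
apply: le_lt_trans xe; apply: le_trans le1.
rewrite mulrC ler_wpM2r//. nra.
Unshelve. all: by end_near. Qed.

End schwartz_estimates.

(** * Monotone symbols are onto *)

Section symbols.
Context {R : realType}.
Implicit Type phi : symbol R.

Lemma iter_comp_op phi n (f : schwartz R) x :
  iter n (comp_op phi) f x = f (iter n phi x).
Proof. by elim: n x => // n IH x; rewrite iterS iterSr -IH. Qed.

Lemma symbol_fun_continuous phi : continuous phi.
Proof.
move=> x; apply/differentiable_continuous/derivable1_diffP.
exact: (@symbol_smooth R phi 0%N x).
Qed.

(** Where [|phi x| <= K], the Gaussian [exp (- x^2)] composed with [phi] is at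
    least [exp (- K^2)]; its decay confines such [x] to a bounded set. *)
Lemma symbol_proper phi (K : R) :
  exists X : R, forall x : R, X <= `|x| -> K < `|phi x|.
Proof.
pose f := gauss_schwartz 0 (@ltr01 R).
pose C := schwartz_seminorm 1 (comp_op phi f).
have C0 : 0 <= C by exact: schwartz_seminorm_ge0.
exists (1 + C * expR (K ^+ 2)) => x; apply: contraTT; rewrite -leNgt -ltNge => xK.
have := Re_schwartz_le1 (comp_op phi f) x; rewrite -/C.
change (complex.Re _) with (gauss 1 0 (phi x)).
rewrite ger0_norm ?expR_ge0//.
have gE : expR (- K ^+ 2) <= gauss 1 0 (phi x).
  rewrite ler_expR lerN2 mul1r subr0 -real_normK ?num_real//.
  by rewrite ler_sqr// ?nnegrE ?(le_trans _ xK).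
have x2 : (0:R) <= 1 + x ^+ 2 by rewrite addr_ge0 ?sqr_ge0.
move=> /(le_trans (ler_wpM2l x2 gE)); rewrite expRN ler_pdivrMr ?expR_gt0//.
rewrite -(@real_normK _ x) ?num_real//.
have : 0 <= C * expR (K ^+ 2) by rewrite mulr_ge0 ?expR_ge0.
move: (C * _) (normr_ge0 x); move: `|x| => t u t0 u0 tu.
by nra.
Qed.

(** By properness [|phi|] is large at [Z] and [- Z]; by monotonicity the two values
    lie on opposite sides of [phi 0], hence of any prescribed [y]. *)
Lemma symbol_onto phi :
  {homo phi : x y / x <= y} \/ {homo phi : x y /~ x <= y} ->
  forall y, exists x, phi x = y.
Proof.
move=> phi_mono y.
have [X HX] := symbol_proper phi (`|y| + `|phi 0|).
pose Z : R := `|X|.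
have Z0 : 0 <= Z by exact: normr_ge0.
have XZ : X <= Z by exact: ler_norm.
have := HX Z; rewrite ger0_norm// => /(_ XZ).
have := HX (- Z); rewrite normrN ger0_norm// => /(_ XZ).
move=> hN hZ.
have [|||x _ <-] := @IVT R phi (- Z) Z y; last by exists x.
- by rewrite (le_trans _ Z0)// oppr_le0.
- by apply: continuous_subspaceT; exact: symbol_fun_continuous.
have up u v : v <= u -> `|y| + `|v| < `|u| -> `|y| <= u.
  move=> vu; have := normr_ge0 y; have := normr_ge0 v.
  have := ler_norm (- v); rewrite normrN.
  by have [u0|u0] := leP 0 u; [rewrite (ger0_norm u0)|rewrite (ltr0_norm u0)]; lra.
have down u v : u <= v -> `|y| + `|v| < `|u| -> u <= - `|y|.
  by move=> uv vu; rewrite lerNr (up (- u) (- v)) ?lerN2// !normrN.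
have ZN : - Z <= 0 by rewrite oppr_le0.
have [m M] : Num.min (phi (- Z)) (phi Z) <= - `|y| /\
             `|y| <= Num.max (phi (- Z)) (phi Z).
  rewrite ge_min le_max; case: phi_mono => phi_mono.
    by rewrite (down _ _ (phi_mono _ _ ZN))// (up _ _ (phi_mono _ _ Z0))// orbT.
  by rewrite (up _ _ (phi_mono _ _ ZN))// (down _ _ (phi_mono _ _ Z0))// orbT.
rewrite (le_trans m) ?(le_trans _ M)//.
  exact: ler_norm.
by rewrite lerNl -normrN ler_norm.
Qed.

End symbols.

(** * Orbits of monotone maps of the line *)

Section monotone_orbits.
Context {R : realType}.
Implicit Types (psi G h : R -> R) (z s : R^nat) (p a x : R).

Lemma fixed_iter psi a n : psi a = a -> iter n psi a = a.
Proof. by move=> pa; elim: n => //= n ->. Qed.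

Definition backward_orbit psi z := forall m, psi (z m.+1) = z m.

Lemma backward_orbit_exists psi x : (forall y, exists x, psi x = y) ->
  exists z, z 0%N = x /\ backward_orbit psi z.
Proof.
move=> /choice[g gK]; exists (fun m => iter m g x); split=> // m.
by rewrite iterS gK.
Qed.

Lemma iter_backward psi z n m : backward_orbit psi z ->
  iter (n + m) psi (z m) = iter n psi (z 0%N).
Proof.
move=> zK; elim: m n => [|m IH] n; first by rewrite addn0.
by rewrite addnS iterSr zK IH.
Qed.

Lemma backward_limit_fixed psi z a : continuous psi -> backward_orbit psi z ->
  z @ \oo --> a -> psi a = a.
Proof.
move=> cpsi zK za; have za1 : (fun m => z m.+1) @ \oo --> a by rewrite cvg_shiftS.
apply: (@cvg_unique _ _ (z @ \oo)) => //.
rewrite (_ : z = fun m => psi (z m.+1)); last exact/funext.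
by apply: continuous_cvg; [exact: cpsi|exact: za1].
Qed.

Lemma forward_limit_fixed psi x a : continuous psi ->
  (fun n => iter n psi x) @ \oo --> a -> psi a = a.
Proof.
move=> cpsi sa; have sa1 : (fun n => iter n.+1 psi x) @ \oo --> a.
  by rewrite (@cvg_shiftS _ (fun n => iter n psi x)).
apply: (@cvg_unique _ _ ((fun n => iter n.+1 psi x) @ \oo)) => //.
by apply: continuous_cvg; [exact: cpsi|exact: sa].
Qed.

(** A backward step against the expected direction would, by monotonicity,
    propagate forward to [z 0]. *)
Lemma backward_orbit_decr psi z : {homo psi : x y / x <= y} ->
  backward_orbit psi z -> z 0%N < psi (z 0%N) -> forall m, z m.+1 < z m.
Proof.
move=> psi_mono zK z0 m; rewrite ltNge; apply/negP.
elim: m => [/psi_mono|m IH /psi_mono]; first by rewrite zK leNgt z0.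
by rewrite !zK.
Qed.

Lemma backward_orbit_incr psi z : {homo psi : x y / x <= y} ->
  backward_orbit psi z -> psi (z 0%N) < z 0%N -> forall m, z m < z m.+1.
Proof.
move=> psi_mono zK z0 m; rewrite ltNge; apply/negP.
elim: m => [/psi_mono|m IH /psi_mono]; first by rewrite zK leNgt z0.
by rewrite !zK.
Qed.

Lemma iter_incr psi x : {homo psi : x y / x <= y} -> x <= psi x ->
  nondecreasing_seq (fun n => iter n psi x).
Proof.
by move=> psi_mono xp; apply/nondecreasing_seqP; elim=> //= n /psi_mono.
Qed.

Lemma iter_decr psi x : {homo psi : x y / x <= y} -> psi x <= x ->
  nonincreasing_seq (fun n => iter n psi x).
Proof.
by move=> psi_mono xp; apply/nonincreasing_seqP; elim=> //= n /psi_mono.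
Qed.

Lemma nonincreasing_bounded_limit s p : nonincreasing_seq s ->
  (forall n, p <= s n) ->
  exists a, [/\ s @ \oo --> a, p <= a & forall n, a <= s n].
Proof.
move=> sd ps; have cs : cvgn s.
  by apply: nonincreasing_is_cvgn sd _; exists p => _ [n _ <-].
exists (limn s); split=> //; last exact: nonincreasing_cvgn_ge.
by apply: limr_ge => //; near=> n; exact: ps.
Unshelve. all: by end_near. Qed.

Lemma nondecreasing_limit s : nondecreasing_seq s ->
  s @ \oo --> +oo \/ exists a, s @ \oo --> a /\ forall n, s n <= a.
Proof.
move=> si; have [cs|ncs] := pselect (cvgn s).
  by right; exists (limn s); split=> // n; exact: nondecreasing_cvgn_le.
by left; exact: nondecreasing_dvgn_lt.
Qed.

(** What a bound on the orbit of each Gaussian for the seminorm of order one says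
    about the iterates: uniform decay and a uniform Lipschitz constant. *)
Definition gauss_bounded psi := forall c, exists C, forall n x y,
  (1 + x ^+ 2) * gauss 1 c (iter n psi x) <= C /\
  `|gauss 1 c (iter n psi x) - gauss 1 c (iter n psi y)| <= C * `|x - y|.

Section bounded_orbits.
Variable psi : R -> R.
Hypotheses (psi_mono : {homo psi : x y / x <= y}) (psi_cont : continuous psi).
Hypothesis psi_onto : forall y, exists x, psi x = y.
Hypothesis psi_bounded : gauss_bounded psi.

(** If [x < psi x], the backward orbit of [x] is bounded by the decay estimate and
    so converges to a fixed point [a < x]; the [n]-th iterate moves points
    arbitrarily close to [a] to [x], against the Lipschitz estimate. *)
Lemma bounded_orbits_le x : psi x <= x.
Proof.
rewrite leNgt; apply/negP => xpsi.
have [C HC] := psi_bounded x.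
have [z [z0 zK]] := backward_orbit_exists x psi_onto.
have zx m : iter m psi (z m) = x by rewrite -z0 -[m in iter m]add0n iter_backward.
have zlt : forall m, z m.+1 < z m.
  by apply: (backward_orbit_decr psi_mono zK); rewrite z0.
(* [|z m| <= 1 + z m ^ 2], which is at most [C] since the Gaussian is [1] at [x]. *)
have zge m : - C <= z m.
  have [+ _] := HC m (z m) 0; rewrite zx gauss_center mulr1; nra.
have [a [za _ az]] := @nonincreasing_bounded_limit z (- C)
  ((nonincreasing_seqP z).1 (fun m => ltW (zlt m))) zge.
have pa := backward_limit_fixed psi_cont zK za.
have ax : a < x by rewrite -z0; exact: le_lt_trans (az 1%N) (zlt 0%N).
have C0 : 0 <= C.
  have [+ _] := HC 0%N x 0; apply: le_trans.
  by rewrite mulr_ge0 ?expR_ge0// addr_ge0 ?sqr_ge0.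
have ga : 0 < 1 - gauss 1 x a.
  by rewrite subr_gt0 expR_lt1 oppr_lt0 mul1r exprn_even_gt0//= subr_eq0 lt_eqF.
have C1 : 0 < C + 1 by rewrite ltr_wpDl.
have /cvgrPdist_lt/(_ _ (divr_gt0 ga C1)) [N _ /(_ N (leqnn N))] := za.
have [_] := HC N (z N) a; rewrite zx gauss_center (fixed_iter _ pa).
rewrite /= (distrC a) ltr_pdivlMr// => h1 h2.
have h3 := ler_norm (1 - gauss 1 x a).
have := normr_ge0 (z N - a); lra.
Qed.

End bounded_orbits.

Lemma iter_opp psi n x : iter n (fun y => - psi (- y)) x = - iter n psi (- x).
Proof. by elim: n => [|n IH] /=; rewrite ?opprK// IH opprK. Qed.

(** Conjugation by the reflection of the line exchanges the two inequalities. *)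
Lemma bounded_orbits_id psi :
  {homo psi : x y / x <= y} -> continuous psi ->
  (forall y, exists x, psi x = y) -> gauss_bounded psi ->
  forall x, psi x = x.
Proof.
move=> psi_mono psi_cont psi_onto psi_bounded x.
apply/eqP; rewrite eq_le bounded_orbits_le//= -lerN2 -{1}(opprK x).
apply: (@bounded_orbits_le (fun y => - psi (- y))).
- by move=> u v uv; rewrite lerN2 psi_mono// lerN2.
- move=> y; apply: cvgN.
  by apply: continuous_cvg; [exact: psi_cont|exact: cvgN].
- by move=> y; have [u pu] := psi_onto (- y); exists (- u); rewrite !(opprK, pu).
move=> c; have [C HC] := psi_bounded (- c); exists C => n u v.
rewrite !iter_opp !gauss_opp; have [] := HC n (- u) (- v).
by rewrite sqrrN -opprD normrN.
Qed.

(** * Cesaro means along orbits *)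

Definition orbit_mean psi G h :=
  forall x, arithmetic_mean (fun k => G (iter k psi x)) @ \oo --> h x.

Lemma orbit_mean_limit psi G h x l : orbit_mean psi G h ->
  G (iter k psi x) @[k --> \oo] --> l -> h x = l.
Proof. by move=> hG /cesaro; apply: cvg_unique => //; exact: hG. Qed.

Lemma orbit_mean_fixed psi G h a : orbit_mean psi G h -> psi a = a -> h a = G a.
Proof.
move=> hG pa; apply: orbit_mean_limit hG _.
rewrite (_ : (fun _ => _) = cst (G a)); first exact: cvg_cst.
by apply/funext => k; rewrite fixed_iter.
Qed.

(** The orbits of all points of a backward orbit have the same tail, so the limit of
    their Cesaro means does not depend on the point. *)
Lemma orbit_mean_backward psi G h z l m : orbit_mean psi G h ->
  backward_orbit psi z ->
  G (iter k psi (z 0%N)) @[k --> \oo] --> l -> h (z m) = l.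
Proof.
move=> hG zK Gl; apply: orbit_mean_limit hG _.
rewrite -(cvg_shiftn m) (_ : (fun _ => _) = fun k => G (iter k psi (z 0%N)))//.
by apply/funext => k; rewrite iter_backward.
Qed.

Definition vanishing G := G x @[x --> +oo] --> (0 : R).

(** If [psi x < x], the forward orbit decreases to a fixed point [c >= p] and the
    backward orbit increases, to a fixed point [d] or to infinity; if [x < psi x] the
    two orbits exchange roles.  Either way [h] along the backward orbit has the
    constant value given by the forward limit of [G], and comparing with the limit
    of [h] at the other end gives the alternative.  The points [c] and [d] do not
    depend on [G], which leaves [G] free to be chosen in terms of them. *)
Lemma orbit_mean_alternative psi p x :
  {homo psi : x y / x <= y} -> continuous psi ->
  (forall y, exists x, psi x = y) -> psi p = p -> p < x -> psi x != x ->
  exists c, [/\ psi c = c, p <= c &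
    (forall G h, orbit_mean psi G h -> continuous G -> continuous h ->
      vanishing G -> vanishing h -> G c = 0) \/
    (exists d, [/\ psi d = d, c < d &
      forall G h, orbit_mean psi G h -> continuous G -> continuous h ->
      G c = G d])].
Proof.
move=> psi_mono psi_cont psi_onto pp px.
have [z [z0 zK]] := backward_orbit_exists x psi_onto.
have const_lim (u : R^nat) (l l' : R) :
    (forall m, u m = l) -> u @ \oo --> l' -> l = l'.
  move=> ul; rewrite (_ : u = cst l); last exact/funext.
  by move=> ll'; apply: (@cvg_unique R _ (cst l @ \oo)) => //; exact: cvg_cst.
rewrite neq_lt => /orP[xlt|xgt].
- have s_decr := iter_decr psi_mono (ltW xlt).
  have [|c [sc pc cs]] := nonincreasing_bounded_limit s_decr (p := p).
    by elim=> [|n IH] /=; [exact: ltW|rewrite -pp psi_mono].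
  have cfix := forward_limit_fixed psi_cont sc.
  exists c; split=> //.
  have z_incr : forall m, z m < z m.+1.
    by apply: (backward_orbit_incr psi_mono zK); rewrite z0.
  have hz G h m : orbit_mean psi G h -> continuous G -> h (z m) = G c.
    move=> hG cG; apply: orbit_mean_backward hG zK _; rewrite z0.
    by apply: continuous_cvg; [exact: cG|exact: sc].
  have [zoo|[d [zd dz]]] := nondecreasing_limit
      ((nondecreasing_seqP z).1 (fun m => ltW (z_incr m))).
    left => G h hG cG ch vG vh; apply: (const_lim (h \o z)).
      by move=> m; exact: hz.
    exact: cvg_comp zoo vh.
  have dfix := backward_limit_fixed psi_cont zK zd.
  right; exists d; split=> //.
    apply: le_lt_trans (cs 0%N) _; rewrite /= -z0.
    exact: lt_le_trans (z_incr 0%N) (dz 1%N).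
  move=> G h hG cG ch; rewrite -(orbit_mean_fixed hG dfix).
  apply: (const_lim (h \o z)) => [m|]; first exact: hz.
  by apply: continuous_cvg; [exact: ch|exact: zd].
- have z_decr : forall m, z m.+1 < z m.
    by apply: (backward_orbit_decr psi_mono zK); rewrite z0.
  have [|c [zc pc cz]] := nonincreasing_bounded_limit
      ((nonincreasing_seqP z).1 (fun m => ltW (z_decr m))) (p := p).
    (* Were the orbit to cross [p], it would have to hit it, and [x] would be [p]. *)
    elim=> [|n IH]; first by rewrite z0 ltW.
    rewrite leNgt; apply/negP => /ltW/psi_mono; rewrite zK pp => zp.
    have zpE : z n = p by apply/eqP; rewrite eq_le zp IH.
    have := iter_backward 0 n zK; rewrite add0n /= zpE fixed_iter// z0.
    by move=> px'; rewrite px' ltxx in px.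
  have cfix := backward_limit_fixed psi_cont zK zc.
  exists c; split=> //.
  have cx : c < x by rewrite -z0; exact: le_lt_trans (cz 1%N) (z_decr 0%N).
  have hc G h : orbit_mean psi G h -> continuous h -> (h \o z) @ \oo --> G c.
    move=> hG ch; rewrite -(orbit_mean_fixed hG cfix).
    by apply: continuous_cvg; [exact: ch|exact: zc].
  have [soo|[d [sd ds]]] := nondecreasing_limit (iter_incr psi_mono (ltW xgt)).
    left => G h hG cG ch vG vh; apply/esym/(const_lim (h \o z)); last exact: hc.
    move=> m; apply: orbit_mean_backward hG zK _; rewrite z0.
    exact: cvg_comp soo vG.
  right; exists d; split.
  + exact: forward_limit_fixed sd.
  + exact: lt_le_trans cx (ds 0%N).
  move=> G h hG cG ch; apply/esym/(const_lim (h \o z)); last exact: hc.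
  move=> m; apply: orbit_mean_backward hG zK _; rewrite z0.
  by apply: continuous_cvg; [exact: cG|exact: sd].
Qed.

End monotone_orbits.

(** * Power boundedness in terms of seminorms *)

Section power_bounded_operators.
Context {R : realType}.
Implicit Type T : {linear schwartz R -> schwartz R}.

Lemma iter_linear0 T n : iter n T 0 = 0.
Proof. by elim: n => //= n ->; rewrite linear0. Qed.

Lemma iter_linearZ T n (a : R[i]) f : iter n T (a *: f) = a *: iter n T f.
Proof. by elim: n => //= n ->; rewrite linearZ. Qed.

Lemma normc_real (a : R) : Normc.normc (a%:C)%C = `|a|.
Proof. exact: norm_real_complex. Qed.

(** Equicontinuity at [0]: a small multiple of [f] has all its iterates in the unit
    ball of the seminorm, and linearity rescales. *)
Lemma power_bounded_seminorm T k f : power_bounded T ->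
  exists C, forall n, schwartz_seminorm k (iter n T f) <= C.
Proof.
move=> Tpb.
have [E entE EV] : exists2 E, entourage E &
    xsection E 0 `<=` schwartz_ball (0 : schwartz R) k 1.
  exact/nbhsP/schwartz_ball_near.
have [N [e [e0 Ne]]] := Tpb 0 E entE.
pose M := schwartz_seminorm N f + 1.
have M0 : 0 < M by rewrite ltr_wpDl// schwartz_seminorm_ge0.
pose a : R := e / M.
have a0 : 0 < a by exact: divr_gt0.
have small n : schwartz_seminorm k (iter n T ((a%:C)%C *: f)) < 1.
  have : schwartz_ball (0 : schwartz R) k 1 (iter n T ((a%:C)%C *: f)).
    apply/EV/xsectionP; rewrite -(iter_linear0 T n).
    apply: Ne => j jN; rewrite subr0.
    apply: (le_lt_trans (schwartz_seminormZ _ _ _)).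
    rewrite normc_real gtr0_norm// -mulrAC ltr_pdivrMr// ltr_pM2l//.
    apply: (le_lt_trans (schwartz_seminorm_mono f jN)).
    by rewrite ltrDl.
  by move=> /(_ k (leqnn k)); rewrite subr0.
exists a^-1 => n; have := ltW (small n); rewrite iter_linearZ => le1.
have -> : iter n T f = (a^-1%:C)%C *: ((a%:C)%C *: iter n T f).
  by rewrite scalerA -rmorphM mulVf ?gt_eqF// scale1r.
apply: (le_trans (schwartz_seminormZ _ _ _)).
by rewrite normc_real gtr0_norm ?invr_gt0// ler_piMr// invr_ge0 ltW.
Qed.

Lemma power_bounded_of_involution T : continuous T ->
  (forall f, T (T f) = f) -> power_bounded T.
Proof.
move=> cT TT f E entE.
have nE : \forall g \near f, E (f, g).
  by have := nbhs_entourage f entE; apply: filterS => g /xsectionP.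
have nTE : \forall g \near f, E (T f, T g).
  have nT : nbhs f (T @^-1` xsection E (T f)).
    exact: (cT f _ (nbhs_entourage (T f) entE)).
  by apply: filterS nT => g /xsectionP.
near=> g => n.
have [even|odd] : (forall h, iter n T h = h) \/ (forall h, iter n T h = T h).
- elim: n => [|n [IH|IH]]; first by left.
    by right => h; rewrite iterS IH.
  by left => h; rewrite iterS IH TT.
- by rewrite !even; near: g.
- by rewrite !odd; near: g.
Unshelve. all: by end_near. Qed.

End power_bounded_operators.

(** * Composition operators *)

Section composition_operators.
Context {R : realType}.
Implicit Type phi : symbol R.

Lemma iter_square (g : R -> R) n x :
  iter n (fun y => g (g y)) x = iter n.*2 g x.
Proof. by elim: n => //= n ->. Qed.

Lemma power_bounded_orbits phi :
  power_bounded (comp_op phi) -> gauss_bounded phi.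
Proof.
move=> pb c; pose f := gauss_schwartz c (@ltr01 R).
have [C HC] := power_bounded_seminorm 1 f pb; exists C => n x y.
have gE z : gauss 1 c (iter n phi z) = complex.Re (iter n (comp_op phi) f z).
  by rewrite iter_comp_op.
rewrite !gE; split.
  apply: le_trans (HC n); apply: le_trans (Re_schwartz_le1 _ x).
  by rewrite ler_wpM2l ?addr_ge0 ?sqr_ge0 ?ler_norm.
apply: (le_trans (Re_schwartz_lipschitz _ _ _)).
by rewrite ler_wpM2r.
Qed.

Lemma power_bounded_increasing phi : {homo phi : x y / x <= y} ->
  power_bounded (comp_op phi) -> forall x, phi x = x.
Proof.
move=> phi_mono pb; apply: bounded_orbits_id => //.
- exact: symbol_fun_continuous.
- by apply: symbol_onto; left.
- exact: power_bounded_orbits.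
Qed.

Lemma cvg_Re_schwartz (I : Type) (F : set_system I) (FF : Filter F)
    (u : I -> schwartz R) (g : schwartz R) x :
  u @ F --> g -> complex.Re (u t x) @[t --> F] --> complex.Re (g x).
Proof.
move=> ug; apply/cvgrPdist_lt => e e0.
have nu : F (u @^-1` schwartz_ball g 0 e).
  exact: (ug _ (schwartz_ball_near g 0 e0)).
apply: filterS nu => t /(_ 0%N isT).
apply: le_lt_trans; apply: le_trans (Re_schwartz_le0 _ x).
rewrite distrC; change ((u t - g) x) with (u t x - g x).
by case: (u t x) (g x) => a b [c d].
Qed.

Lemma sum_pairs (F : nat -> R) n :
  \sum_(1 <= k < n.*2.+1) F k = \sum_(0 <= k < n) (F k.*2.+1 + F k.*2.+2).
Proof.
elim: n => [|n IH]; first by rewrite !big_geq.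
rewrite doubleS (big_nat_recr n.*2.+2)//= (big_nat_recr n.*2.+1)//= IH.
by rewrite (big_nat_recr n)//= addrA.
Qed.

Lemma cvg_even (u : R^nat) (l : R) :
  u @ \oo --> l -> (fun n => u n.+1.*2) @ \oo --> l.
Proof.
move=> ul; apply: (cvg_comp (fun n => n.+1.*2) u _ ul).
move=> A [N _ NA]; exists N => // n /= Nn.
by apply: NA; rewrite /= (leq_trans Nn)// -addnn addSn leqW// leq_addr.
Qed.

(** Grouping the terms in pairs turns a mean along the orbits of a map into a mean
    along the orbits of its square. *)
Lemma arithmetic_mean_pairs (F : nat -> R) n :
  arithmetic_mean (fun k => 2^-1 * (F k.*2.+1 + F k.*2.+2)) n =
  n.+1.*2%:R^-1 * \sum_(1 <= k < n.+1.*2.+1) F k.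
Proof.
rewrite sum_pairs /arithmetic_mean/= /series/= -mulr_sumr mulrA.
by congr (_ * _); rewrite -mul2n natrM invfM mulrC.
Qed.

Lemma Re_cesaro_mean phi n (f : schwartz R) x :
  complex.Re (cesaro_mean (comp_op phi) n f x) =
  n%:R^-1 * \sum_(1 <= k < n.+1) complex.Re (f (iter k phi x)).
Proof.
rewrite /cesaro_mean; set S := \sum_(_ <= _ < _) iter _ _ _.
have -> : n%:R^-1 = ((n%:R^-1 : R)%:C)%C :> R[i] by rewrite fmorphV rmorph_nat.
change (complex.Re (((n%:R^-1 : R)%:C)%C * S x) =
  n%:R^-1 * \sum_(1 <= k < n.+1) complex.Re (f (iter k phi x))).
have -> : \sum_(1 <= k < n.+1) complex.Re (f (iter k phi x)) = complex.Re (S x).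
  rewrite /S (big_morph (fun h : schwartz R => complex.Re (h x))
    (id1 := 0) (op1 := +%R)) //.
    by apply: eq_bigr => k _; rewrite iter_comp_op.
  move=> g h; change ((g + h) x) with (g x + h x).
  by case: (g x) (h x) => a b [c d].
by case: (S x) => a b /=; rewrite mul0r subr0.
Qed.

(** * Decreasing symbols *)

Section decreasing_symbol.
Variable phi : symbol R.
Hypothesis phi_anti : {homo phi : x y /~ x <= y}.

Let psi x := phi (phi x).

Let psi_mono : {homo psi : x y / x <= y}.
Proof. by move=> x y xy; do 2 apply: phi_anti. Qed.

Let psi_cont : continuous psi.
Proof.
move=> x; apply: continuous_comp; exact: symbol_fun_continuous.
Qed.

Let psi_onto y : exists x, psi x = y.
Proof.
have phi_onto := @symbol_onto _ phi (or_intror phi_anti).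
have [u <-] := phi_onto y; have [v <-] := phi_onto u.
by exists v.
Qed.

Lemma power_bounded_decreasing :
  power_bounded (comp_op phi) -> forall x, phi (phi x) = x.
Proof.
move=> pb; apply: (@bounded_orbits_id _ psi) => // c.
have [C HC] := power_bounded_orbits pb c; exists C => n x y.
by rewrite !iter_square.
Qed.

Lemma decreasing_fixed_point : exists p, phi p = p.
Proof.
pose q := phi 0.
have [|||p _ pE] := @IVT R (fun x => phi x - x) (Num.min 0 q) (Num.max 0 q) 0.
- by rewrite ge_min le_max lexx.
- apply: continuous_subspaceT => x; apply: cvgB; last exact: cvg_id.
  exact: symbol_fun_continuous.
- have [q0|q0] := leP 0 q.
    have := phi_anti q0; rewrite -/q => pq.
    by rewrite subr0 ge_min le_max subr_le0 pq q0 orbT.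
  have := phi_anti (ltW q0); rewrite -/q => pq.
  by rewrite subr0 ge_min le_max subr_ge0 pq (ltW q0) orbT.
by exists p; apply/eqP; rewrite -subr_eq0 pE.
Qed.

(** The function [g] is the limit of the Cesaro means of [f]; convergence for the
    Schwartz topology implies pointwise convergence, and means over an
    even number of terms are paired. *)
Lemma mean_ergodic_orbit_mean (f : schwartz R) : mean_ergodic (comp_op phi) ->
  exists g : schwartz R, orbit_mean psi
   (fun x => 2^-1 * (complex.Re (f (phi x)) + complex.Re (f (psi x))))
   (fun x => complex.Re (g x)).
Proof.
move=> [P [_ HP]]; exists (P f) => x.
have lim := @cvg_Re_schwartz _ _ eventually_filter _ _ x (HP f).
pose F k := complex.Re (f (iter k phi x)).
have -> : (fun k => 2^-1 * (complex.Re (f (phi (iter k psi x))) +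
    complex.Re (f (psi (iter k psi x))))) =
    (fun k => 2^-1 * (F k.*2.+1 + F k.*2.+2)).
  by apply/funext => k; rewrite /psi iter_square.
have -> : arithmetic_mean (fun k => 2^-1 * (F k.*2.+1 + F k.*2.+2)) =
    (fun n => complex.Re (cesaro_mean (comp_op phi) n.+1.*2 f x)).
  by apply/funext => n; rewrite arithmetic_mean_pairs Re_cesaro_mean.
exact: (cvg_even lim).
Qed.

Lemma mean_ergodic_decreasing :
  mean_ergodic (comp_op phi) -> forall x, phi (phi x) = x.
Proof.
move=> me; have [p pp] := decreasing_fixed_point.
have psip : psi p = p by rewrite /psi !pp.
(* A point below [p] is the image of a point above it, and [phi] commutes with
   [psi]. *)
suff above x : p < x -> psi x = x.
  move=> x; have [xp|px|->] := ltgtP x p; [|exact: above|exact: psip].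
  have [z zx] := symbol_onto (or_intror phi_anti) x.
  have pz : p < z.
    by rewrite ltNge; apply/negP => /phi_anti; rewrite pp zx leNgt xp.
  by rewrite -zx; congr (phi _); exact: above.
move=> px; apply/eqP/negPn/negP => xnfix.
pose G f y := 2^-1 * (complex.Re (f (phi y)) + complex.Re (f (psi y))) : R.
have Gcont (f : schwartz R) : continuous (G f).
  move=> y; apply: cvgM; first exact: cvg_cst.
  apply: cvgD; first exact: (@Re_schwartz_continuous _ (comp_op phi f) y).
  exact: (@Re_schwartz_continuous _ (comp_op phi (comp_op phi f)) y).
have Gvan (f : schwartz R) : vanishing (G f).
  rewrite /vanishing -(mulr0 (2^-1 : R)) -(addr0 (0 : R)).
  apply: cvgM; first exact: cvg_cst.
  apply: cvgD; first exact: (Re_schwartz_vanishes (comp_op phi f)).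
  exact: (Re_schwartz_vanishes (comp_op phi (comp_op phi f))).
have [c [cfix pc alt]] :=
  orbit_mean_alternative psi_mono psi_cont psi_onto psip px xnfix.
case: alt => [zero|[d [dfix cd same]]].
  pose f := gauss_schwartz 0 (@ltr01 R).
  have [g hg] := mean_ergodic_orbit_mean f me.
  have := zero _ _ hg (Gcont f) (@Re_schwartz_continuous _ g)
    (Gvan f) (Re_schwartz_vanishes g).
  have := gauss_gt0 1 0 (phi c); have := gauss_gt0 1 0 (psi c).
  rewrite /gauss_schwartz /=; lra.
(* With this [L] the Gaussian centred at [d] is [exp (-2) <= 1/3] at [c], and no
   larger at [phi c <= c]; so [G c <= 1/3], while [G d > 1/2]. *)
pose L := 2 / (d - c) ^+ 2.
have dc : 0 < (d - c) ^+ 2 by rewrite exprn_gt0// subr_gt0.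
have L0 : 0 < L by exact: divr_gt0.
pose f := gauss_schwartz d L0.
have [g hg] := mean_ergodic_orbit_mean f me.
have := same _ _ hg (Gcont f) (@Re_schwartz_continuous _ g).
rewrite cfix dfix /gauss_schwartz /= gauss_center.
have pcc : phi c <= c.
  by apply: le_trans (phi_anti pc) _; rewrite pp.
have far : gauss L d (phi c) <= gauss L d c.
  rewrite ler_expR lerN2 ler_wpM2l ?(ltW L0)//.
  by move: pcc cd; nra.
have small : gauss L d c * 3 <= 1.
  rewrite /gauss /L -(sqrrN (c - d)) opprB divfK ?gt_eqF//.
  rewrite expRN mulrC ler_pdivrMr ?expR_gt0// mul1r.
  by have := expR_ge1Dx (2 : R); lra.
by have := gauss_gt0 L d (phi d); lra.
Qed.

End decreasing_symbol.

(** * Involutive symbols *)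

(** The iterates alternate between [T f] and [f], so that the mean deviates from
    [(T f + f) / 2] only through the unpaired term of an odd [n]. *)
Lemma cesaro_mean_involution phi n (f : schwartz R) :
  (forall x, phi (phi x) = x) -> (0 < n)%N ->
  cesaro_mean (comp_op phi) n f - 2^-1 *: (comp_op phi f + f) =
  (((odd n)%:R / 2 / n%:R : R)%:C)%C *: (comp_op phi f - f).
Proof.
move=> phi2 n0.
have iterE k : iter k (comp_op phi) f = if odd k then comp_op phi f else f.
  elim: k => //= k ->; case: odd => //=; apply/val_inj/funext => x /=.
  by rewrite phi2.
have sumE m : \sum_(1 <= k < m.+1) iter k (comp_op phi) f =
    (m%:R / 2) *: (comp_op phi f + f) + ((odd m)%:R / 2) *: (comp_op phi f - f).
  elim: m => [|m IH]; first by rewrite big_geq// !mul0r !scale0r addr0.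
  rewrite big_nat_recr// [in LHS]/= IH -iterS iterE oddS.
  move: (comp_op phi f) => g; apply/val_inj/funext => x.
  change (m%:R / 2 * (g x + f x) + (odd m)%:R / 2 * (g x - f x) +
    (if ~~ odd m then g else f) x =
    m.+1%:R / 2 * (g x + f x) + (~~ odd m)%:R / 2 * (g x - f x)).
  by case: odd => /=; rewrite -[m.+1]addn1 natrD; field.
rewrite /cesaro_mean sumE.
have nC : n%:R != 0 :> R[i] by rewrite pnatr_eq0 -lt0n.
rewrite scalerDr !scalerA mulrA mulVf// mul1r addrAC subrr add0r.
by congr (_ *: _); rewrite !rmorphM/= !fmorphV !rmorph_nat mulrC.
Qed.

Lemma mean_ergodic_involution phi : (forall x, phi (phi x) = x) ->
  mean_ergodic (comp_op phi).
Proof.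
move=> phi2.
pose P : {linear schwartz R -> schwartz R} := 2^-1 \*: (comp_op phi \+ idfun).
have PE f : P f = 2^-1 *: (comp_op phi f + f) by [].
exists P; split.
  move=> f; have addc : (fun g => comp_op phi g + g) @ f --> comp_op phi f + f.
    have Tc : comp_op phi g @[g --> f] --> comp_op phi f.
      exact: (@symbol_continuous _ phi f).
    have idc : g @[g --> f] --> f by exact: cvg_id.
    apply: (cvg_comp2 Tc idc).
    exact: (@add_continuous (schwartz R) (comp_op phi f, f)).
  have cstc : (fun _ : schwartz R => 2^-1 : R[i]^o) @ f --> (2^-1 : R[i]^o).
    exact: (@cvg_cst _ _ _ _ (nbhs_filter f)).
  apply: (cvg_comp2 cstc addc).
  exact: (@scale_continuous _ (schwartz R) (2^-1, comp_op phi f + f)).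
move=> f U [N [e [e0 NeU]]].
pose v := comp_op phi f - f.
suff nearU : \forall n \near \oo, U (cesaro_mean (comp_op phi) n f) by [].
near=> n; apply: NeU => k kN.
have n0 : (0 < n)%N by near: n; exact: nbhs_infty_gt.
have nR : (0 : R) < n%:R by rewrite ltr0n.
rewrite PE cesaro_mean_involution//.
apply: (le_lt_trans (schwartz_seminormZ _ _ _)).
rewrite normc_real.
have ne : schwartz_seminorm N v < e * n%:R.
  rewrite mulrC -ltr_pdivrMr//; near: n; exact: nbhs_infty_gtr.
rewrite ger0_norm ?divr_ge0// mulrAC ltr_pdivrMr//.
apply: le_lt_trans ne; apply: le_trans (schwartz_seminorm_mono v kN).
rewrite ler_piMl ?schwartz_seminorm_ge0//.
by rewrite ler_pdivrMr// mul1r ler_nat; case: odd.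
Unshelve. all: by end_near. Qed.

End composition_operators.

(** * The characterization *)

Theorem theorem3p5 (R : realType) (phi : symbol R) :
  ({homo phi : x y / x <= y} ->
    (power_bounded (comp_op phi) <-> forall x, phi x = x)) /\
  ({homo phi : x y /~ x <= y} ->
    (power_bounded (comp_op phi) <-> mean_ergodic (X := schwartz R) (comp_op phi)) /\
    (mean_ergodic (comp_op phi) <-> forall x, phi (phi x) = x)).
Proof.
have invol_pb : (forall x, phi (phi x) = x) -> power_bounded (comp_op phi).
  move=> phi2; apply: power_bounded_of_involution.
    exact: symbol_continuous.
  by move=> f; apply/val_inj/funext => x /=; rewrite phi2.
split=> phi_mono.
  split; first exact: power_bounded_increasing.
  by move=> phi1; apply: invol_pb => x; rewrite !phi1.
split; split.
- by move=> /(power_bounded_decreasing phi_mono)/mean_ergodic_involution.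
- by move=> /(mean_ergodic_decreasing phi_mono)/invol_pb.
- exact: mean_ergodic_decreasing.
- exact: mean_ergodic_involution.
Qed.
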